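(* There exists a universal constant $C>0$ such that for all positive $\mu_1,\mu_2,\lambda,D,\epsilon$ there is a deterministic second-order algorithm with the following guarantee: for every $d$ and every function $f:\mathbb{R}^d\to\mathbb{R}$ which is $\lambda$-strongly convex, twice-differentiable, with $\mu_1$-Lipschitz gradients and $\mu_2$-Lipschitz Hessians, and whose minimizer $\mathbf{w}^*$ satisfies $\|\mathbf{w}_1-\mathbf{w}^*\|\leq D$ (where $\mathbf{w}_1$ is the initialization point), the algorithm reaches a point $\mathbf{w}_T$ with $f(\mathbf{w}_T)-f(\mathbf{w}^* )\leq\epsilon$ after a number of oracle calls $T$ of at most $$C\left(\left(\frac{\mu_2D}{\lambda}\right)^{2/7}\log_2\left(\frac{\mu_1\mu_2^2D^2}{\lambda^3}\right)+\log\log_2\left(\frac{\lambda^3}{\mu_2^2\epsilon}\right)\right),$$ where each of the quantities $\left(\frac{\mu_2D}{\lambda}\right)^{2/7}$, $\log_2\left(\frac{\mu_1\mu_2^2D^2}{\lambda^3}\right)$ and $\log\log_2\left(\frac{\lambda^3}{\mu_2^2\epsilon}\right)$ is replaced by $1$ if it is undefined or smaller than $1$.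
   Context: A second-order oracle for $f$, given a point $\mathbf{w}$, returns $f(\mathbf{w})$, $\nabla f(\mathbf{w})$ and $\nabla^2 f(\mathbf{w})$. A deterministic second-order algorithm produces a sequence of points $\mathbf{w}_1,\mathbf{w}_2,\ldots$ in $\mathbb{R}^d$, where each $\mathbf{w}_t$ is a deterministic function of the oracle's responses at $\mathbf{w}_1,\ldots,\mathbf{w}_{t-1}$; computational resources between oracle calls are not limited, and the algorithm may depend on the problem parameters. Norms are Euclidean for vectors and spectral for matrices; Lipschitz continuity of $\nabla f$, $\nabla^2f$ is with respect to these norms. A twice-differentiable $f$ is $\lambda$-strongly convex if $\nabla^2 f(\mathbf{w})\succeq\lambda I$ for all $\mathbf{w}$. *)

(* Defs.v *)
From HB Require Import structures.
From mathcomp Require Import all_boot all_order all_algebra.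
From mathcomp Require Import all_classical all_reals all_analysis.
Set Implicit Arguments.
Unset Strict Implicit.
Unset Printing Implicit Defensive.
Import Order.TTheory GRing.Theory Num.Theory.
Import numFieldNormedType.Exports.
Local Open Scope classical_set_scope.
Local Open Scope ring_scope.

(* The norm `|v| of the library on matrices is the max norm, hence the explicit
   Euclidean norm. Both induce the same topology, so differentiability in the
   sense of the library is the usual one. *)
Definition enorm (R : realType) (d : nat) (v : 'rV[R]_d) : R :=
  Num.sqrt (\sum_(i < d) v 0 i ^+ 2).

(* Operator norm induced by the Euclidean norm. Vectors are rows and matrices
   act on the right; A and A^T have the same spectral norm. *)
Definition spectral_norm (R : realType) (m n : nat) (A : 'M[R]_(m, n)) : R :=
  sup [set enorm (v *m A) | v in [set v : 'rV[R]_m | enorm v <= 1]].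

Definition gradient (R : realType) (d : nat) (f : 'rV[R]_d -> R)
    (w : 'rV[R]_d) : 'rV[R]_d :=
  \row_(j < d) 'D_(delta_mx 0 j) f w.

Definition hessian (R : realType) (d : nat) (f : 'rV[R]_d -> R)
    (w : 'rV[R]_d) : 'M[R]_d :=
  'J (gradient f) w.

Definition twice_differentiable (R : realType) (d : nat)
    (f : 'rV[R]_d -> R) : Prop :=
  (forall w, differentiable f w) /\ (forall w, differentiable (gradient f) w).

(* Symmetry is not required: it is automatic for the Hessian of a twice
   differentiable function. *)
Definition psd (R : realType) (d : nat) (A : 'M[R]_d) : Prop :=
  forall v : 'rV[R]_d, 0 <= (v *m A *m v^T) 0 0.

Definition strongly_convex (R : realType) (d : nat) (lambda : R)
    (f : 'rV[R]_d -> R) : Prop :=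
  forall w, psd (hessian f w - lambda%:M).

Definition lipschitz_gradient (R : realType) (d : nat) (mu : R)
    (f : 'rV[R]_d -> R) : Prop :=
  forall v w, enorm (gradient f v - gradient f w) <= mu * enorm (v - w).

Definition lipschitz_hessian (R : realType) (d : nat) (mu : R)
    (f : 'rV[R]_d -> R) : Prop :=
  forall v w, spectral_norm (hessian f v - hessian f w) <= mu * enorm (v - w).

Definition minimizer (R : realType) (d : nat) (f : 'rV[R]_d -> R)
    (w : 'rV[R]_d) : Prop :=
  forall v, f w <= f v.

Definition response (R : realType) (d : nat) : Type :=
  (R * 'rV[R]_d * 'M[R]_d)%type.

Definition oracle (R : realType) (d : nat) (f : 'rV[R]_d -> R)
    (w : 'rV[R]_d) : response R d :=
  (f w, gradient f w, hessian f w).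

(* An arbitrary map from the list of past responses, oldest first, to the next
   query point; the first query point is its value on the empty list. *)
Definition algorithm (R : realType) (d : nat) : Type :=
  seq (response R d) -> 'rV[R]_d.

Fixpoint responses (R : realType) (d : nat) (A : algorithm R d)
    (f : 'rV[R]_d -> R) (t : nat) : seq (response R d) :=
  if t is t'.+1 then
    let past := responses A f t' in rcons past (oracle f (A past))
  else [::].

(* The t-th point w_t, indexed from t = 1: it depends on the responses at
   w_1, ..., w_(t-1) only. *)
Definition query (R : realType) (d : nat) (A : algorithm R d)
    (f : 'rV[R]_d -> R) (t : nat) : 'rV[R]_d :=
  A (responses A f t.-1).

Definition log2 (R : realType) (x : R) : R := ln x / ln 2.

(* ln x = 0 for x <= 0, so Num.max 1 replaces by 1 both the values smaller than
   1 and the undefined ones (ln (log2 x) for 0 < x <= 1). *)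
Definition complexity (R : realType) (mu1 mu2 lambda D eps : R) : R :=
  Num.max 1 ((mu2 * D / lambda) `^ (2 / 7)) *
    Num.max 1 (log2 (mu1 * mu2 ^+ 2 * D ^+ 2 / lambda ^+ 3)) +
  Num.max 1 (ln (log2 (lambda ^+ 3 / (mu2 ^+ 2 * eps)))).

(* Main.v *)
Require Import Defs.
From HB Require Import structures.
From mathcomp Require Import all_boot all_order all_algebra.
From mathcomp Require Import all_classical all_reals all_analysis.
From mathcomp Require Import ring lra.
Set Implicit Arguments.
Unset Strict Implicit.
Unset Printing Implicit Defensive.
Import Order.TTheory GRing.Theory Num.Theory.
Import numFieldNormedType.Exports.
Local Open Scope classical_set_scope.
Local Open Scope ring_scope.

(** The method combines an accelerated regularized Newton method, restarted
    until the distance to the minimizer is of order lambda / mu2, with the pure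
    Newton method, which converges quadratically from there.

    The accelerated phase keeps a best point x, a dual point v and a counter j.
    It extrapolates to a point y between x and v with the weights A_j = eta j^3
    and makes a Newton step s from y, regularized by l >= l_j where l_j is
    proportional to 1 / (j+1). The condition l >= 2 mu2 |s| makes the new point
    approximately stationary for the regularized problem. The potential A_j (f x - fmin) + |v - xmin|^2 / 2 then never
    increases ([accelerated_step_bound]), and there are two cases
    ([step_potential]). Either l = l_j is admissible, and j is incremented; or a
    larger l is needed, found by doubling ([regularized_step]), and then the step
    is long, of length at least l_j / (4 mu2), and the surplus A_(j+1) l_j |s|^2
    of the estimate lowers the potential by a fixed multiple of
    A_(j+1) l_j^3 / mu2^2. The cubic weights make this quantity independent
    of j, hence of order 1 / (eta^2 mu2^2). The horizon is known beforehand, so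
    the regularizations l_j can be prescribed: no line search is needed to match l
    and the extrapolation weights.

    With eta = 4 / (lambda N^3), N increments of j give A_N = 4 / lambda, which by
    strong convexity halves the distance to the minimizer. At most N of the other
    steps fit into the initial potential D^2 / 2 if N^7 is at least a constant
    times (mu2 D / lambda)^2. So 2 N steps halve the distance ([epoch_halves]);
    this is where the exponent 2/7 comes from. The same N serves all the restarts,
    of which about log2 (mu2 D / lambda) are needed; since lambda <= mu1, a
    multiple of the logarithm in the complexity is enough.

    In the last phase the gradient norm, in the unit lambda^2 / mu2, is squared by
    each Newton step, and it controls the gap through
    f - fmin <= |grad f|^2 / (2 lambda). The first step turns a bound on the
    distance into a bound on the gradient that does not involve mu1
    ([residual_first_newton]); so the number of Newton steps depends only on
    lambda^3 / (mu2^2 eps). *)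

(** * Euclidean geometry of row vectors *)

Definition dotv (R : realType) (d : nat) (u v : 'rV[R]_d) : R :=
  (u *m v^T) 0 0.

Section Dot.
Variables (R : realType) (d : nat).
Implicit Types (u v w : 'rV[R]_d) (a : R).

Lemma dotvE u v : dotv u v = \sum_(i < d) u 0 i * v 0 i.
Proof. by rewrite /dotv !mxE; apply: eq_bigr => i _; rewrite !mxE. Qed.

Lemma dotvC u v : dotv u v = dotv v u.
Proof. by rewrite !dotvE; apply: eq_bigr => i _; rewrite mulrC. Qed.

Lemma dotvDl u v w : dotv (u + v) w = dotv u w + dotv v w.
Proof. by rewrite /dotv mulmxDl mxE. Qed.

Lemma dotvZl a u w : dotv (a *: u) w = a * dotv u w.
Proof. by rewrite /dotv -scalemxAl mxE. Qed.

Lemma dotvNl u w : dotv (- u) w = - dotv u w.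
Proof. by rewrite /dotv mulNmx mxE. Qed.

Lemma dotvDr u v w : dotv w (u + v) = dotv w u + dotv w v.
Proof. by rewrite ![dotv w _]dotvC dotvDl. Qed.

Lemma dotvZr a u w : dotv w (a *: u) = a * dotv w u.
Proof. by rewrite ![dotv w _]dotvC dotvZl. Qed.

Lemma dotvNr u w : dotv w (- u) = - dotv w u.
Proof. by rewrite ![dotv w _]dotvC dotvNl. Qed.

Definition dotv_lin := (dotvDl, dotvDr, dotvNl, dotvNr, dotvZl, dotvZr).

Lemma dotv0 v : dotv 0 v = 0.
Proof. by rewrite /dotv mul0mx mxE. Qed.

Lemma dotv_ge0 v : 0 <= dotv v v.
Proof. by rewrite dotvE; apply: sumr_ge0 => i _; rewrite -expr2 sqr_ge0. Qed.

Lemma dotv_eq0 v : dotv v v = 0 -> v = 0.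
Proof.
rewrite dotvE => /psumr_eq0P h; apply/rowP => i.
have /eqP : v 0 i * v 0 i = 0 by apply: h => // j _; rewrite -expr2 sqr_ge0.
by rewrite mulf_eq0 orbb => /eqP ->; rewrite mxE.
Qed.

Lemma dotvv v : dotv v v = enorm v ^+ 2.
Proof.
have -> : enorm v = Num.sqrt (dotv v v).
  by rewrite /enorm dotvE; congr Num.sqrt; apply: eq_bigr => i _; rewrite expr2.
by rewrite sqr_sqrtr ?dotv_ge0.
Qed.

Lemma enorm_ge0 v : 0 <= enorm v.
Proof. exact: sqrtr_ge0. Qed.

Lemma enorm0 : enorm (0 : 'rV[R]_d) = 0.
Proof. by apply/eqP; rewrite -sqrf_eq0 -dotvv dotv0. Qed.

Lemma enorm_eq0 v : enorm v = 0 -> v = 0.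
Proof. by move=> h; apply: dotv_eq0; rewrite dotvv h expr0n. Qed.

Lemma enormZ a v : enorm (a *: v) = `|a| * enorm v.
Proof.
apply: (@pexpIrn _ 2) => //; rewrite ?nnegrE ?mulr_ge0 ?enorm_ge0//.
by rewrite -dotvv !dotv_lin dotvv exprMn real_normK ?num_real//; ring.
Qed.

Lemma enormN v : enorm (- v) = enorm v.
Proof. by rewrite -scaleN1r enormZ normrN1 mul1r. Qed.

Lemma enormB u v : enorm (u - v) = enorm (v - u).
Proof. by rewrite -enormN opprB. Qed.

Lemma Cauchy_Schwarz u v : dotv u v <= enorm u * enorm v.
Proof.
have [v0|v0] := eqVneq (enorm v) 0.
  by rewrite v0 mulr0 (enorm_eq0 v0) dotvC dotv0.
have [u0|u0] := eqVneq (enorm u) 0.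
  by rewrite u0 mul0r (enorm_eq0 u0) dotv0.
have up : 0 < enorm u by rewrite lt_def u0 enorm_ge0.
have vp : 0 < enorm v by rewrite lt_def v0 enorm_ge0.
have := dotv_ge0 (enorm v *: u - enorm u *: v).
rewrite !dotv_lin !dotvv (dotvC v u).
set a := enorm u in up *; set b := enorm v in vp *; set c := dotv u v => h.
have : 0 <= 2 * (a * b) * (a * b - c) by move: h; congr (0 <= _); ring.
by rewrite pmulr_rge0 ?subr_ge0// mulr_gt0 ?mulr_gt0.
Qed.

Lemma Cauchy_SchwarzN u v : - dotv u v <= enorm u * enorm v.
Proof. by rewrite -dotvNl -(enormN u) Cauchy_Schwarz. Qed.

Lemma enormD u v : enorm (u + v) <= enorm u + enorm v.
Proof.
rewrite -(@ler_pXn2r _ 2)// ?nnegrE ?addr_ge0 ?enorm_ge0//.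
rewrite -dotvv !dotv_lin !dotvv (dotvC v u).
by have := Cauchy_Schwarz u v; nra.
Qed.

(** The supremum over the unit ball is an upper bound only because the image of
    the ball is bounded; the squared norms of the columns provide a bound. *)
Lemma enorm_mulmx (A : 'M[R]_d) v :
  enorm (v *m A) <= spectral_norm A * enorm v.
Proof.
pose K := 1 + \sum_(j < d) enorm (col j A)^T ^+ 2.
have K1 : 1 <= K by rewrite lerDl sumr_ge0// => j _; rewrite sqr_ge0.
have bnd u : enorm u <= 1 -> enorm (u *m A) <= K.
  move=> u1; rewrite -(@ler_pXn2r _ 2)// ?nnegrE ?enorm_ge0//; last first.
    by rewrite (le_trans ler01).
  apply: (@le_trans _ _ K); last by rewrite expr2 ler_peMl ?(le_trans ler01).
  rewrite -dotvv dotvE ler_wpDl//; apply: ler_sum => j _; rewrite -expr2.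
  have -> : (u *m A) 0 j = dotv u (col j A)^T.
    by rewrite dotvE mxE; apply: eq_bigr => i _; rewrite !mxE.
  rewrite -[leLHS]real_normK ?num_real// ler_pXn2r ?nnegrE ?enorm_ge0//.
  have h : enorm u * enorm (col j A)^T <= enorm (col j A)^T.
    by rewrite ler_piMl// enorm_ge0.
  rewrite ler_norml; apply/andP; split.
    by have := Cauchy_SchwarzN u (col j A)^T; lra.
  exact: le_trans (Cauchy_Schwarz _ _) h.
have [v0|v0] := eqVneq (enorm v) 0.
  by rewrite v0 mulr0 (enorm_eq0 v0) mul0mx enorm0.
have vp : 0 < enorm v by rewrite lt_def v0 enorm_ge0.
rewrite -ler_pdivrMr// mulrC.
have -> : (enorm v)^-1 * enorm (v *m A) = enorm (((enorm v)^-1 *: v) *m A).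
  by rewrite -scalemxAl enormZ ger0_norm// invr_ge0 ltW.
apply: ub_le_sup.
  by exists K => _ /= [u u1 <-]; exact: bnd.
exists ((enorm v)^-1 *: v) => //=.
by rewrite enormZ gtr0_norm ?invr_gt0// mulVf.
Qed.

End Dot.

(** * Calculus along segments *)

Section Segment.
Variables (R : realType) (d : nat).
Implicit Types (x s u w : 'rV[R]_d) (t : R).

Lemma is_derive_segment (V : normedModType R) (F : 'rV[R]_d -> V) x s t :
  differentiable F (x + t *: s) ->
  is_derive t 1 (fun t => F (x + t *: s)) ('d F (x + t *: s) s).
Proof.
move=> dF; rewrite -deriveE//.
have := @diff_derivable _ _ _ F (x + t *: s) s dF.
have E : (fun h : R => h^-1 *: (((fun t => F (x + t *: s)) \o shift t)
             (h *: (1 : R)) - F (x + t *: s))) =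
         (fun h : R => h^-1 *: ((F \o shift (x + t *: s)) (h *: s)
             - F (x + t *: s))).
  apply/funext => h /=; congr (_ *: (F _ - _)).
  by rewrite [h *: 1]mulr1 scalerDl addrCA.
by move=> ?; split; rewrite /derivable /derive E.
Qed.

Lemma MVT01 (phi dphi : R -> R) :
  (forall t, is_derive t 1 phi (dphi t)) ->
  exists2 c, 0 < c < 1 & phi 1 - phi 0 = dphi c.
Proof.
move=> dphiP.
have cphi : {within `[0, 1], continuous phi}.
  apply: continuous_subspaceT => t.
  by apply/differentiable_continuous/derivable1_diffP; exact: ex_derive.
have [c] := MVT ltr01 (fun c _ => dphiP c) cphi.
by rewrite in_itv /= subr0 mulr1 => cI E; exists c.
Qed.

Lemma is_derive_dotv (F : R -> 'rV[R]_d) (v u : 'rV[R]_d) t :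
  is_derive t 1 F v -> is_derive t 1 (fun t => dotv (F t) u) (dotv v u).
Proof.
move=> dF; have dM : derivable F t 1 by exact: ex_derive.
have E := derive_mx dM.
rewrite derive_val in E.
have dc j : derivable (fun r : R => F r 0 j) t 1 by move/derivable_mxP : dM; apply.
have -> : (fun t => dotv (F t) u) =
    (\sum_(j < d) (u 0 j *: (fun r : R => F r 0 j : R^o)))%R.
  apply/funext => y; rewrite dotvE fct_sumE; apply: eq_bigr => j _.
  by rewrite mulrC.
rewrite dotvE.
have -> : \sum_(i < d) v 0 i * u 0 i =
    (\sum_(j < d) (u 0 j *: 'D_1 (fun r : R => F r 0 j : R^o) t))%R.
  by apply: eq_bigr => j _; rewrite E mxE mulrC.
apply: is_derive_sum => j.
by apply: is_deriveZ; apply: DeriveDef.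
Qed.

End Segment.

Section StronglyConvex.
Variables (R : realType) (d : nat) (f : 'rV[R]_d -> R) (lambda mu2 : R).
Hypothesis f_diff : twice_differentiable f.
Hypothesis f_sc : strongly_convex lambda f.
Hypothesis f_hess : lipschitz_hessian mu2 f.
Implicit Types (x s u w : 'rV[R]_d) (t : R).

Lemma diff_gradient w s : 'd f w s = dotv (gradient f w) s.
Proof.
rewrite [in LHS](row_sum_delta s) linear_sum /= dotvE.
apply: eq_bigr => j _; rewrite linearZ /= mxE mulrC deriveE//.
by case: f_diff.
Qed.

Lemma is_derive_f x s t :
  is_derive t 1 (fun t => f (x + t *: s)) (dotv (gradient f (x + t *: s)) s).
Proof.
by rewrite -diff_gradient; apply: is_derive_segment; case: f_diff.
Qed.

Lemma is_derive_gradient x s u t :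
  is_derive t 1 (fun t => dotv (gradient f (x + t *: s)) u)
    (dotv (s *m hessian f (x + t *: s)) u).
Proof.
apply: is_derive_dotv; rewrite /hessian /jacobian mul_rV_lin1.
by apply: is_derive_segment; case: f_diff.
Qed.

Lemma hessian_lower_bound w s :
  lambda * enorm s ^+ 2 <= dotv (s *m hessian f w) s.
Proof.
have := f_sc w s.
rewrite mulmxBr mulmxBl mul_mx_scalar -scalemxAl mxE [in X in _ + X]mxE.
by rewrite subr_ge0 [in X in X <= _]mxE -dotvv.
Qed.

Lemma gradient_monotone x s :
  lambda * enorm s ^+ 2 <= dotv (gradient f (x + s) - gradient f x) s.
Proof.
have [c _] := MVT01 (is_derive_gradient x s s).
rewrite scale1r scale0r addr0 dotvDl dotvNl => ->.
exact: hessian_lower_bound.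
Qed.

(** The difference of the two sides, along the segment, has a nonnegative
    derivative by monotonicity of the gradient. *)
Lemma strong_convexity_bound x s :
  f x + dotv (gradient f x) s + lambda / 2 * enorm s ^+ 2 <= f (x + s).
Proof.
pose phi t := f (x + t *: s) - (dotv (gradient f x) s * t
                + lambda / 2 * enorm s ^+ 2 * t ^+ 2).
have dphi t : is_derive t 1 phi (dotv (gradient f (x + t *: s)) s -
    (dotv (gradient f x) s + lambda * enorm s ^+ 2 * t)).
  have df := is_derive_f x s t.
  apply: is_derive_eq; set q := dotv (gradient f (_ + _)) s.
  rewrite /GRing.scale /=.
  by field.
have [c /andP[c0 _]] := MVT01 dphi.
rewrite /phi scale1r scale0r addr0.
have := gradient_monotone x (c *: s).
rewrite dotvZr enormZ exprMn real_normK ?num_real// dotvDl dotvNl => h.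
have : lambda * enorm s ^+ 2 * c <=
    dotv (gradient f (x + c *: s)) s - dotv (gradient f x) s.
  by rewrite -(ler_pM2l c0); lra.
lra.
Qed.

Lemma convexity_bound : 0 <= lambda -> forall x y,
  f x + dotv (gradient f x) (y - x) <= f y.
Proof.
move=> l0 x y; have := strong_convexity_bound x (y - x).
rewrite subrKC => /(le_trans _); apply; rewrite lerDl.
by rewrite mulr_ge0 ?divr_ge0// sqr_ge0.
Qed.

(** The derivative of the pairing of the remainder with a fixed vector is at
    most mu2 |s|^2 times the norm of that vector; the vector to pair with is the
    remainder itself. *)
Lemma gradient_taylor x s : 0 <= mu2 ->
  enorm (gradient f (x + s) - gradient f x - s *m hessian f x)
    <= mu2 * enorm s ^+ 2.
Proof.
move=> mu20.
have [e eE] : exists e, e = gradient f (x + s) - gradient f x - s *m hessian f x.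
  by eexists.
have [k kE] : exists k, k = dotv (s *m hessian f x) e by eexists.
rewrite -eE.
pose phi t := dotv (gradient f (x + t *: s)) e - k * t.
have dphi t : is_derive t 1 phi
    (dotv (s *m hessian f (x + t *: s)) e - k).
  have dg := is_derive_gradient x s e t.
  apply: is_derive_eq; move: (dotv (s *m hessian f (_ + _)) e) => q.
  by rewrite /GRing.scale /=; ring.
have [c /andP[c0 c1]] := MVT01 dphi.
rewrite /phi kE scale1r scale0r addr0 mulr0 mulr1 subr0.
have <- : enorm e ^+ 2 = dotv (gradient f (x + s)) e
    - dotv (s *m hessian f x) e - dotv (gradient f x) e.
  by rewrite -dotvv [X in dotv X _ = _]eE; rewrite !dotvDl !dotvNl; ring.
rewrite -dotvNl -dotvDl -mulmxBr => E.
have : enorm e ^+ 2 <= mu2 * enorm s ^+ 2 * enorm e.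
  rewrite E (le_trans (Cauchy_Schwarz _ _))// ler_wpM2r ?enorm_ge0//.
  rewrite (le_trans (enorm_mulmx _ _))// expr2 mulrA.
  rewrite ler_wpM2r ?enorm_ge0// (le_trans (f_hess _ _))// ler_wpM2l//.
  by rewrite [x + _]addrC addrK enormZ gtr0_norm// ler_piMl ?enorm_ge0// ltW.
have [->|e0] := eqVneq (enorm e) 0; first by rewrite mulr_ge0 ?sqr_ge0.
by rewrite expr2 ler_pM2r// lt_def e0 enorm_ge0.
Qed.

Variable wstar : 'rV[R]_d.
Hypothesis f_min : minimizer f wstar.

Lemma gradient_minimizer : gradient f wstar = 0.
Proof.
apply: dotv_eq0; set g := gradient f wstar.
have df t := is_derive_f wstar g t.
have d0 : is_derive (0 : R) 1 (fun t => f (wstar + t *: g)) 0.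
  apply: (@derive1_at_min _ _ (-1) 1).
  - by lra.
  - by move=> t _; exact: ex_derive.
  - by rewrite in_itv /=; apply/andP; split; lra.
  - by move=> t _; rewrite scale0r addr0; exact: f_min.
have := df 0; rewrite scale0r addr0 => d1.
by rewrite -(@derive_val _ _ _ _ _ _ _ d1) (@derive_val _ _ _ _ _ _ _ d0).
Qed.

Lemma gap_lower_bound w :
  lambda / 2 * enorm (w - wstar) ^+ 2 <= f w - f wstar.
Proof.
have := strong_convexity_bound wstar (w - wstar).
by rewrite gradient_minimizer dotv0 subrKC; lra.
Qed.

(** Minimize over s the strong convexity bound for f (w + s). *)
Lemma gap_upper_bound w : 0 < lambda ->
  f w - f wstar <= enorm (gradient f w) ^+ 2 / (2 * lambda).
Proof.
move=> l0; have := strong_convexity_bound w (wstar - w).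
rewrite subrKC ler_pdivlMr ?mulr_gt0// => h.
move: h; move: (wstar - w) (gradient f w) => p g.
have := dotv_ge0 (g + lambda *: p); rewrite !dotv_lin !dotvv (dotvC p).
set a := dotv _ _; set b := enorm _; set c := enorm _ => hge0 h.
have : 0 <= b ^+ 2 + 2 * lambda * a + lambda ^+ 2 * c ^+ 2.
  by move: hge0; congr (_ <= _); ring.
have : lambda * (f w + a + lambda / 2 * c ^+ 2) <= lambda * f wstar.
  by rewrite ler_pM2l.
by lra.
Qed.

End StronglyConvex.

(** Compare both bounds on the variation of the gradient along a unit vector,
    which exists in positive dimension only. *)
Lemma strong_convexity_le_lipschitz (R : realType) d (f : 'rV[R]_d.+1 -> R)
    (lambda mu1 : R) :
  twice_differentiable f -> strongly_convex lambda f ->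
  lipschitz_gradient mu1 f -> lambda <= mu1.
Proof.
move=> f_diff f_sc f_lip; pose e : 'rV[R]_d.+1 := delta_mx 0 0.
have e1 : enorm e = 1.
  apply: (@pexpIrn _ 2) => //; rewrite ?nnegrE ?enorm_ge0//.
  rewrite expr1n -dotvv dotvE (bigD1 0)//= big1 ?addr0 ?mxE ?eqxx ?mulr1//.
  by move=> j j0; rewrite !mxE (negPf j0) mulr0.
have := gradient_monotone f_diff f_sc 0 e.
have := f_lip (0 + e) 0.
have := Cauchy_Schwarz (gradient f (0 + e) - gradient f 0) e.
by rewrite subr0 add0r e1; lra.
Qed.

(** * Newton systems *)

Section NewtonSystem.
Variables (R : realType) (d : nat).
Implicit Types (B : 'M[R]_d) (g s : 'rV[R]_d) (l : R).

Lemma coercive_unitmx B l : 0 < l ->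
  (forall v, l * enorm v ^+ 2 <= dotv (v *m B) v) -> B \in unitmx.
Proof.
move=> l0 Bl; rewrite -row_free_unit -kermx_eq0; apply/eqP/row_matrixP => i.
rewrite row0; apply: enorm_eq0; apply/eqP; rewrite -sqrf_eq0 eq_le sqr_ge0 andbT.
rewrite -(pmulr_rle0 _ l0) (le_trans (Bl _))//.
by rewrite -row_mul mulmx_ker row0 dotv0.
Qed.

Lemma coercive_solution_bound B g s l :
  (forall v, l * enorm v ^+ 2 <= dotv (v *m B) v) ->
  s *m B = - g -> l * enorm s <= enorm g.
Proof.
move=> Bl sB.
have [->|s0] := eqVneq (enorm s) 0; first by rewrite mulr0 enorm_ge0.
have sp : 0 < enorm s by rewrite lt_def s0 enorm_ge0.
rewrite -(ler_pM2r sp) -mulrA -expr2 (le_trans (Bl s))// sB dotvNl.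
exact: Cauchy_SchwarzN.
Qed.

Section Regularized.
Variable B : 'M[R]_d.
Hypothesis B_psd : forall v, 0 <= dotv (v *m B) v.

Lemma regularized_coercive l v :
  l * enorm v ^+ 2 <= dotv (v *m (B + l%:M)) v.
Proof. by rewrite mulmxDr mul_mx_scalar dotvDl dotvZl dotvv lerDr. Qed.

Lemma regularized_solution g l : 0 < l -> exists s, s *m (B + l%:M) = - g.
Proof.
move=> l0; exists (- g *m invmx (B + l%:M)); rewrite mulmxKV//.
exact: coercive_unitmx l0 (regularized_coercive l).
Qed.

(** With u solving u (B + 2 l) = s1, the vector 2 s2 - s1 equals u B, which has
    a nonnegative inner product with s1 = u B + 2 l u. *)
Lemma regularized_doubling g l s1 s2 : 0 < l ->
  s1 *m (B + l%:M) = - g -> s2 *m (B + (2 * l)%:M) = - g ->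
  enorm s1 <= 2 * enorm s2.
Proof.
move=> l0 e1 e2; have l20 : 0 < 2 * l by rewrite mulr_gt0.
have [u eu] := regularized_solution (- s1) l20; rewrite opprK in eu.
have BU := coercive_unitmx l20 (regularized_coercive _).
have eD : 2 *: s2 - s1 = u *m B.
  apply: (can_inj (mulmxK BU)).
  rewrite mulmxBl -scalemxAl e2 -e1 -mulmxA.
  have -> : B *m (B + (2 * l)%:M) = (B + (2 * l)%:M) *m B.
    by rewrite mulmxDr mulmxDl scalar_mxC.
  rewrite mulmxA eu !mulmxDr !mul_mx_scalar scalerDr scalerA opprD addrACA subrr addr0.
  by rewrite scaler_nat mulr2n addrK.
have h : 0 <= dotv (2 *: s2 - s1) s1.
  rewrite eD -eu mulmxDr mul_mx_scalar dotvDr dotvZr.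
  by rewrite addr_ge0 ?dotv_ge0// mulr_ge0// ltW.
have [->|s0] := eqVneq (enorm s1) 0; first by rewrite mulr_ge0 ?enorm_ge0.
have sp : 0 < enorm s1 by rewrite lt_def s0 enorm_ge0.
have := Cauchy_Schwarz s2 s1.
move: h; rewrite dotvDl dotvNl dotvZl dotvv => h cs.
by rewrite -(ler_pM2r sp); lra.
Qed.

(** The regularization is doubled until the step is short enough for it. Since
    a doubling at most halves the step, the step is not too short either, unless
    the initial regularization is already large enough. *)
Lemma regularized_step g (l0 K : R) : 0 < l0 -> 0 < K ->
  exists p : R * 'rV[R]_d,
    [/\ p.2 *m (B + p.1%:M) = - g, l0 <= p.1, K * enorm p.2 <= p.1
      & p.1 = l0 \/ l0 <= 2 * K * enorm p.2].
Proof.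
move=> l0p Kp.
pose l k : R := 2 ^+ k * l0.
have lp k : 0 < l k by rewrite mulr_gt0 ?exprn_gt0.
have /choice[s sP] k : exists s, s *m (B + (l k)%:M) = - g.
  exact: regularized_solution.
have lk k : k%:R * l0 <= l k.
  rewrite ler_pM2r// -natrX ler_nat; exact/ltnW/ltn_expl.
have lk0 k : l0 <= l k by rewrite ler_peMl ?exprn_ege1 ?ler1n// ltW.
have ex : exists k, K * enorm (s k) <= l k.
  pose k := (Num.truncn (K * enorm g / (l0 * l0))).+1; exists k.
  have h : l k * enorm (s k) <= enorm g.
    exact: coercive_solution_bound (regularized_coercive _) (sP k).
  rewrite -(ler_pM2l (lp k)) mulrCA.
  apply: (@le_trans _ _ (K * enorm g)); first by rewrite ler_pM2l.
  have : K * enorm g / (l0 * l0) <= k%:R by rewrite ltW ?truncnS_gt.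
  rewrite ler_pdivrMr ?mulr_gt0// => /le_trans; apply.
  rewrite mulrA; apply: ler_pM => //; last exact: ltW.
  by rewrite mulr_ge0 ?ler0n// ltW.
case: (ex_minnP ex) => [[|k]] Pk min_k.
  exists (l 0%N, s 0%N); split; [exact: sP|exact: lk0|exact: Pk|].
  by left; rewrite /l /= expr0 mul1r.
exists (l k.+1, s k.+1); split; [exact: sP|exact: lk0|exact: Pk|].
right; rewrite /=; have eS : l k.+1 = 2 * l k by rewrite /l exprS mulrA.
have := regularized_doubling (lp k) (sP k); rewrite -eS => /(_ _ (sP k.+1)) h.
have {min_k} : l k < K * enorm (s k).
  by rewrite ltNge; apply/negP => /min_k; rewrite ltnn.
have := lk0 k; have : K * enorm (s k) <= K * (2 * enorm (s k.+1)).
  by rewrite ler_pM2l.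
lra.
Qed.

End Regularized.
End NewtonSystem.

(** * Programs of oracle calls *)

Section Programs.
Variables (R : realType) (d : nat).

(** A decision tree: the calls are nodes, which makes it possible to chain
    procedures without any bookkeeping of the list of past responses. *)
Inductive prog : Type :=
| Done of 'rV[R]_d
| Ask of 'rV[R]_d & (response R d -> prog).

Fixpoint algorithm_of (p : prog) (past : seq (response R d)) : 'rV[R]_d :=
  match p, past with
  | Done w, _ => w
  | Ask w _, [::] => w
  | Ask _ k, r :: past' => algorithm_of (k r) past'
  end.

Variable f : 'rV[R]_d -> R.

Fixpoint advance (n : nat) (p : prog) : prog :=
  match n, p with
  | n'.+1, Ask w k => advance n' (k (oracle f w))
  | _, _ => p
  end.

Lemma advance_Done n w : advance n (Done w) = Done w.
Proof. by case: n. Qed.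

Lemma advanceD m n p : advance (m + n) p = advance n (advance m p).
Proof. by elim: m p => [|m IH] [w|w k] //=; rewrite ?advance_Done// addSn. Qed.

Lemma responses_recl (A : algorithm R d) n :
  responses A f n.+1 =
  oracle f (A [::]) :: responses (fun s => A (oracle f (A [::]) :: s)) f n.
Proof. by elim: n => // n IH; rewrite [LHS]/= -/(responses A f n.+1) IH. Qed.

Lemma query_advance n p :
  query (algorithm_of p) f n.+1 = algorithm_of (advance n p) [::].
Proof.
elim: n p => [|n IH] [w|w k] //.
by rewrite /query [n.+2.-1]/= responses_recl /= -IH.
Qed.

End Programs.

(** * The accelerated method *)

(** In the expansion of the new square distance, the linear term is handled by
    a (v - xs) = A1 (y - z) + A0 (z - x) + a (z - xs), where z = y + s, and the
    convexity bounds at z; the square of the gradient g costs at most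
    A1 |g|^2 / (2 l) because l0 a^2 <= A1. The approximate stationarity
    |g + l s| <= l |s| / 2 pays for it and leaves a surplus in |s|^2. *)
Lemma accelerated_step_bound (R : realType) d (x v y s g xs : 'rV[R]_d)
    (A0 a A1 l0 l fx fz fs : R) :
  A1 = A0 + a -> 0 <= A0 -> 0 <= a -> 0 < l0 -> l0 <= l -> l0 * a ^+ 2 <= A1 ->
  A1 *: y = A0 *: x + a *: v ->
  enorm (g + l *: s) <= l / 2 * enorm s ->
  fz + dotv g (x - (y + s)) <= fx ->
  fz + dotv g (xs - (y + s)) <= fs ->
  l0 / l * A1 * (fz - fs) + 2^-1 * enorm (v - (l0 / l * a) *: g - xs) ^+ 2
    + 3 / 8 * A1 * l0 * enorm s ^+ 2
  <= l0 / l * A0 * (fx - fs) + 2^-1 * enorm (v - xs) ^+ 2.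
Proof.
move=> eA A00 a0 l0p l0l l0a ey hms hx hs.
have lp : 0 < l := lt_le_trans l0p l0l.
have {}hms : enorm g ^+ 2 + 2 * l * dotv g s + 3 / 4 * l ^+ 2 * enorm s ^+ 2 <= 0.
  move: hms; rewrite -(@ler_pXn2r _ 2)// ?nnegrE ?mulr_ge0 ?enorm_ge0 ?invr_ge0
    ?(ltW lp)//.
  by rewrite -[X in X <= _ -> _]dotvv !dotv_lin !dotvv (dotvC s g); lra.
have rp : 0 < l0 / l by rewrite divr_gt0.
have rl : l0 / l * l = l0 by rewrite mulfVK ?gt_eqF.
move: (l0 / l) rp rl => r rp rl.
have ev : v - (r * a) *: g - xs = (v - xs) - (r * a) *: g by rewrite addrAC.
have -> : enorm (v - (r * a) *: g - xs) ^+ 2 = enorm (v - xs) ^+ 2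
    - 2 * r * (a * dotv g (v - xs)) + r ^+ 2 * a ^+ 2 * enorm g ^+ 2.
  rewrite ev -!dotvv; move: (v - xs) => w.
  by rewrite !dotv_lin (dotvC w g); ring.
have -> : a * dotv g (v - xs) = - A1 * dotv g s - A0 * dotv g (x - (y + s))
    - a * dotv g (xs - (y + s)).
  have : dotv g (A1 *: y) = A0 * dotv g x + a * dotv g v.
    by rewrite ey !dotv_lin.
  by rewrite !dotv_lin eA => h; lra.
move: (dotv g (x - _)) (dotv g (xs - _)) hx hs => p q hx hs.
have h1 : r * A0 * p <= r * A0 * (fx - fz).
  by rewrite ler_wpM2l ?mulr_ge0 ?(ltW rp)//; lra.
have h2 : r * a * q <= r * a * (fs - fz).
  by rewrite ler_wpM2l ?mulr_ge0 ?(ltW rp)//; lra.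
move: (enorm_ge0 g) (enorm_ge0 s) hms => + +.
move: (enorm g) (enorm s) (dotv g s) => G S c G0 S0 hms.
have h3 : r ^+ 2 * a ^+ 2 * G ^+ 2 * l <= r * A1 * G ^+ 2.
  have -> : r ^+ 2 * a ^+ 2 * G ^+ 2 * l = r * (l0 * a ^+ 2) * G ^+ 2.
    by rewrite -rl; ring.
  by rewrite ler_wpM2r ?sqr_ge0// ler_wpM2l ?(ltW rp).
have A1p : 0 <= A1 by rewrite eA addr_ge0.
have h4 : r * A1 * (G ^+ 2 + 2 * l * c + 3 / 4 * l ^+ 2 * S ^+ 2) <= 0.
  by rewrite mulr_ge0_le0 ?mulr_ge0 ?(ltW rp).
have h5 : r * A1 * c + 2^-1 * (r ^+ 2 * a ^+ 2 * G ^+ 2)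
    + 3 / 8 * A1 * l0 * S ^+ 2 <= 0.
  rewrite -(pmulr_lle0 _ lp) -rl; lra.
rewrite eA in h5 *; lra.
Qed.

Section Method.
Variables (R : realType) (d : nat) (mu2 eta : R).

Definition weight (j : nat) : R := eta * j%:R ^+ 3.

(** Acceleration requires reg j (weight (j+1) - weight j)^2 <= weight (j+1). The
    increments are of order 3 eta j^2, so the order is 1 / (9 eta j). *)
Definition reg (j : nat) : R := (9 * eta * j.+1%:R)^-1.

Definition iterate : Type := ('rV[R]_d * 'rV[R]_d * nat)%type.

Definition extrapolation (st : iterate) : 'rV[R]_d :=
  let: (x, v, j) := st in
  (weight j.+1)^-1 *: (weight j *: x + (weight j.+1 - weight j) *: v).

(** The regularization together with the corresponding Newton step. The four
    conditions are those of [regularized_step]: a pair exists by doubling the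
    regularization, and nothing else about the chosen pair matters. *)
Definition newton_step (j : nat) (r : response R d) : R * 'rV[R]_d :=
  xget (0, 0) [set p : R * 'rV[R]_d |
    [/\ p.2 *m (r.2 + p.1%:M) = - r.1.2, reg j <= p.1,
        2 * mu2 * enorm p.2 <= p.1
      & p.1 = reg j \/ reg j <= 2 * (2 * mu2) * enorm p.2]].

(** The dual step is scaled down by reg j / p.1 when the regularization had to be
    increased; the weight is then left unchanged. *)
Definition update (st : iterate) (p : R * 'rV[R]_d) (z : 'rV[R]_d)
    (rx rz : response R d) : iterate :=
  let: (x, v, j) := st in
  (if rz.1.1 <= rx.1.1 then z else x,
   v - (reg j / p.1 * (weight j.+1 - weight j)) *: rz.1.2,
   if p.1 == reg j then j.+1 else j).

Definition step_prog (st : iterate) (k : iterate -> prog R d) : prog R d :=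
  let: (x, v, j) := st in
  Ask x (fun rx => let y := extrapolation st in
  Ask y (fun ry => let p := newton_step j ry in
  Ask (y + p.2) (fun rz => k (update st p (y + p.2) rx rz)))).

(** The continuation k receives the state reached, so that procedures of known
    length can be chained. *)
Fixpoint steps_prog (n : nat) (st : iterate) (k : iterate -> prog R d) :=
  if n is n'.+1 then step_prog st (fun st' => steps_prog n' st' k) else k st.

Fixpoint epochs_prog (N m : nat) (x : 'rV[R]_d) (k : 'rV[R]_d -> prog R d) :=
  if m is m'.+1 then
    steps_prog N (x, x, 0%N) (fun st => epochs_prog N m' st.1.1 k)
  else k x.

Fixpoint newton_prog (n : nat) (x : 'rV[R]_d) : prog R d :=
  if n is n'.+1 then
    Ask x (fun r => newton_prog n' (x - r.1.2 *m invmx r.2))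
  else Done x.

Variable f : 'rV[R]_d -> R.

Definition step (st : iterate) : iterate :=
  let y := extrapolation st in
  let p := newton_step st.2 (oracle f y) in
  update st p (y + p.2) (oracle f st.1.1) (oracle f (y + p.2)).

Definition epoch (N : nat) (x : 'rV[R]_d) : 'rV[R]_d :=
  (iter N step (x, x, 0%N)).1.1.

Definition newton (x : 'rV[R]_d) : 'rV[R]_d :=
  x - gradient f x *m invmx (hessian f x).

Lemma advance_steps n st k :
  advance f (3 * n) (steps_prog n st k) = k (iter n step st).
Proof.
elim: n st => [//|n IH] [[x v] j].
by rewrite mulnS advanceD iterSr -IH.
Qed.

Lemma advance_epochs N m x k :
  advance f (3 * N * m) (epochs_prog N m x k) = k (iter m (epoch N) x).
Proof.
elim: m x => [|m IH] x; first by rewrite muln0.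
by rewrite mulnS advanceD iterSr -IH advance_steps.
Qed.

Lemma advance_newton n x : advance f n (newton_prog n x) = Done (iter n newton x).
Proof. by elim: n x => // n IH x; rewrite iterSr -IH. Qed.

(** * Convergence of the accelerated method *)

Variables (lambda : R) (xs : 'rV[R]_d).
Hypotheses (mu2_gt0 : 0 < mu2) (eta_gt0 : 0 < eta) (lambda_gt0 : 0 < lambda).
Hypothesis f_diff : twice_differentiable f.
Hypothesis f_sc : strongly_convex lambda f.
Hypothesis f_hess : lipschitz_hessian mu2 f.
Hypothesis f_min : minimizer f xs.

Lemma weight_ge0 j : 0 <= weight j.
Proof. by rewrite mulr_ge0 ?exprn_ge0 ?ler0n// ltW. Qed.

Lemma weight_gt0 j : 0 < weight j.+1.
Proof. by rewrite mulr_gt0 ?exprn_gt0 ?ltr0n. Qed.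

Lemma le_weight i j : (i <= j)%N -> weight i <= weight j.
Proof.
by move=> ij; rewrite ler_pM2l// ler_pXn2r ?nnegrE ?ler0n// ler_nat.
Qed.

Lemma reg_gt0 j : 0 < reg j.
Proof. by rewrite invr_gt0 !mulr_gt0 ?ltr0n. Qed.

Lemma reg_weight j :
  reg j * (weight j.+1 - weight j) ^+ 2 <= weight j.+1.
Proof.
rewrite mulrC ler_pdivrMr ?mulr_gt0 ?ltr0n//.
rewrite /weight -(natr1 j); have : 0 <= j%:R :> R by [].
move: j%:R => t t0.
have h : (3 * t ^+ 2 + 3 * t + 1) ^+ 2 <= (3 * (t + 1) ^+ 2) ^+ 2.
  by rewrite ler_pXn2r ?nnegrE//; nra.
have : eta ^+ 2 * (3 * t ^+ 2 + 3 * t + 1) ^+ 2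
    <= eta ^+ 2 * (3 * (t + 1) ^+ 2) ^+ 2 by rewrite ler_wpM2l ?sqr_ge0.
by congr (_ <= _); ring.
Qed.

Lemma weight_reg j : weight j.+1 * reg j ^+ 3 = (3 ^+ 6 * eta ^+ 2)^-1.
Proof.
rewrite /weight /reg; have : j.+1%:R != 0 :> R by rewrite pnatr_eq0.
by move: j.+1%:R => t t0; field; rewrite t0 gt_eqF.
Qed.

Lemma newton_stepP j y (p := newton_step j (oracle f y)) :
  [/\ p.2 *m (hessian f y + p.1%:M) = - gradient f y, reg j <= p.1,
      2 * mu2 * enorm p.2 <= p.1
    & p.1 = reg j \/ reg j <= 2 * (2 * mu2) * enorm p.2].
Proof.
apply: (@xgetPex _ (0, 0) [set p : R * 'rV[R]_d |
  [/\ p.2 *m (hessian f y + p.1%:M) = - gradient f y, reg j <= p.1,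
      2 * mu2 * enorm p.2 <= p.1
    & p.1 = reg j \/ reg j <= 2 * (2 * mu2) * enorm p.2]]).
apply: regularized_step; rewrite ?reg_gt0 ?mulr_gt0// => v.
rewrite (le_trans _ (hessian_lower_bound f_sc _ _))//.
by rewrite mulr_ge0 ?sqr_ge0// ltW.
Qed.

Definition potential (st : iterate) : R :=
  weight st.2 * (f st.1.1 - f xs) + 2^-1 * enorm (st.1.2 - xs) ^+ 2.

Definition short_step_gain : R := (2 ^+ 7 * 3 ^+ 5 * eta ^+ 2 * mu2 ^+ 2)^-1.

(** Either the prescribed regularization is large enough, and the weight grows;
    or a larger one is needed, which means that the step is long, and the
    potential drops by a constant. *)
Lemma step_potential st :
  (step st).2 = st.2.+1 /\ potential (step st) <= potential st \/
  (step st).2 = st.2 /\ potential (step st) + short_step_gain <= potential st.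
Proof.
case: st => [[x v] j]; rewrite /step.
set y := extrapolation _; have := newton_stepP j y.
rewrite [(x, v, j).2]/= [(x, v, j).1.1]/=.
move: (newton_step j (oracle f y)) => [l s] [/= hs hl hls hlong].
have rj := reg_gt0 j; have lp : 0 < l by exact: lt_le_trans hl.
have cvx := convexity_bound f_diff f_sc (ltW lambda_gt0) (y + s).
have ey : weight j.+1 *: y = weight j *: x + (weight j.+1 - weight j) *: v.
  by rewrite scalerA divff ?scale1r// gt_eqF// weight_gt0.
have hms : enorm (gradient f (y + s) + l *: s) <= l / 2 * enorm s.
  have -> : l *: s = - gradient f y - s *m hessian f y.
    by rewrite -hs mulmxDr mul_mx_scalar addrAC subrr add0r.
  rewrite addrA (le_trans (gradient_taylor f_diff f_hess _ _ (ltW mu2_gt0)))//.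
  by rewrite expr2 mulrA ler_wpM2r ?enorm_ge0//; lra.
have wj := le_weight (leqnSn j).
have := accelerated_step_bound (esym (subrKC (weight j) (weight j.+1)))
  (weight_ge0 j) _ rj hl
  (reg_weight j) ey hms (cvx x) (cvx xs).
rewrite subr_ge0 => /(_ wj); rewrite /potential /=.
set r := reg j / l; set v' := v - _ *: _.
have [Emin0 Ex Ez] : [/\ 0 <= f (if f (y + s) <= f x then y + s else x) - f xs,
    f (if f (y + s) <= f x then y + s else x) - f xs <= f x - f xs
  & f (if f (y + s) <= f x then y + s else x) - f xs <= f (y + s) - f xs].
  rewrite subr_ge0; split; first exact: f_min.
    by rewrite lerD2r; case: ifP.
  by rewrite lerD2r; case: ifPn => // /negbTE; case: ltgtP.
move: (f (if _ then _ else _) - f xs) Emin0 Ex Ez => e e0 ex ez h.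
have Aj0 := weight_ge0 j; have Ak := weight_gt0 j.
have c0 : 0 <= 3 / 8 * weight j.+1 * reg j.
  by apply: mulr_ge0 (ltW rj); apply: mulr_ge0 (ltW Ak); lra.
have [lE|lE] := eqVneq l (reg j).
  left; split=> //; move: h; rewrite /v' /r lE divff ?gt_eqF// !mul1r => h.
  have := ler_wpM2l (ltW Ak) ez.
  have : 0 <= 3 / 8 * weight j.+1 * reg j * enorm s ^+ 2.
    by rewrite mulr_ge0 ?sqr_ge0.
  lra.
right; split=> //.
(* The larger weight A_j + r a is not recorded: f (x') - f xs >= 0 makes it
   possible to keep the weight A_j, and x', the better of x and z, obeys the convex combination of
   both bounds. *)
have {hlong} hlong : reg j <= 4 * mu2 * enorm s.
  by case: hlong => [/eqP|]; [rewrite (negbTE lE)|lra].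
have r0 : 0 < r by rewrite divr_gt0.
have r1 : r <= 1 by rewrite ler_pdivrMr// mul1r.
have g1 : short_step_gain <= 3 / 8 * weight j.+1 * reg j * enorm s ^+ 2.
  have -> : short_step_gain = 3 / 8 * (weight j.+1 * reg j ^+ 3) / (4 * mu2) ^+ 2.
    by rewrite weight_reg /short_step_gain; field; rewrite !gt_eqF.
  have -> : 3 / 8 * (weight j.+1 * reg j ^+ 3) / (4 * mu2) ^+ 2 =
    3 / 8 * weight j.+1 * reg j * (reg j / (4 * mu2)) ^+ 2.
    by field; rewrite gt_eqF.
  rewrite ler_wpM2l//.
  have t0 : 0 < reg j / (4 * mu2) by rewrite divr_gt0 ?mulr_gt0.
  rewrite ler_pXn2r ?nnegrE ?enorm_ge0 ?(ltW t0)//.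
  by rewrite ler_pdivrMr ?mulr_gt0// mulrC.
have h1 : weight j * e <= r * weight j.+1 * (f (y + s) - f xs)
    + (1 - r) * weight j * (f x - f xs).
  have : r * weight j * e <= r * weight j.+1 * (f (y + s) - f xs).
    apply: ler_pM => //; last by rewrite ler_pM2l.
    exact: mulr_ge0 (ltW r0) Aj0.
  have : (1 - r) * weight j * e <= (1 - r) * weight j * (f x - f xs).
    by apply: ler_wpM2l => //; apply: mulr_ge0 Aj0; rewrite subr_ge0.
  lra.
lra.
Qed.

Lemma steps_potential n st : exists u : nat,
  ((iter n step st).2 + u = st.2 + n)%N /\
  potential (iter n step st) + u%:R * short_step_gain <= potential st.
Proof.
elim: n => [|n [u [ju pu]]]; first by exists 0%N; rewrite !addn0 mul0r addr0.
rewrite iterS; have [[-> h]|[-> h]] := step_potential (iter n step st).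
  by exists u; rewrite addSn ju addnS; split => //; lra.
by exists u.+1; rewrite !addnS ju; split => //; rewrite -natr1; lra.
Qed.

Lemma potential_ge st :
  weight st.2 * (lambda / 2 * enorm (st.1.1 - xs) ^+ 2) <= potential st.
Proof.
apply: ler_wpDr; first by rewrite mulr_ge0 ?sqr_ge0.
by apply: ler_wpM2l; [exact: weight_ge0|exact: gap_lower_bound].
Qed.

End Method.

(** After 2 N steps either N of them have made the weight grow to 4 / lambda,
    or more than N of them have consumed more than the initial potential. *)
Lemma epoch_halves (R : realType) d (f : 'rV[R]_d -> R) (lambda mu2 D : R)
    (xs x : 'rV[R]_d) (N : nat) :
  0 < mu2 -> 0 < lambda -> 0 < D -> (0 < N)%N ->
  twice_differentiable f -> strongly_convex lambda f ->
  lipschitz_hessian mu2 f -> minimizer f xs ->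
  12 ^+ 5 * (mu2 * D / lambda) ^+ 2 <= N%:R ^+ 7 ->
  enorm (x - xs) <= D ->
  enorm (epoch mu2 (4 / (lambda * N%:R ^+ 3)) f (2 * N) x - xs) <= D / 2.
Proof.
move=> mu20 l0 D0 N0 f_diff f_sc f_hess f_min hN hx.
have n0 : 0 < N%:R :> R by rewrite ltr0n.
have [eta etaE] : exists eta, eta = 4 / (lambda * N%:R ^+ 3) by eexists.
rewrite -etaE.
have eta0 : 0 < eta by rewrite etaE divr_gt0 ?mulr_gt0 ?exprn_gt0.
have [u [ju]] := steps_potential mu20 eta0 l0 f_diff f_sc f_hess f_min
  (2 * N) (x, x, 0%N).
rewrite /epoch; set st := iter _ _ _ in ju *.
have pot := potential_ge eta0 f_diff f_sc f_min st.
have g0 : 0 < short_step_gain mu2 eta.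
  by rewrite invr_gt0 !mulr_gt0 ?exprn_gt0.
rewrite [X in _ <= X -> _]/potential /weight /= expr0n /= mulr0 mul0r add0r => hp.
have hD : 2^-1 * enorm (x - xs) ^+ 2 <= 2^-1 * D ^+ 2.
  by rewrite ler_pM2l// ler_pXn2r ?nnegrE ?enorm_ge0 ?(ltW D0).
have [jN|jN] := leqP N st.2.
  have w4 : 4 / lambda <= weight eta st.2.
    apply: le_trans (le_weight eta0 jN).
    suff -> : weight eta N = 4 / lambda by [].
    by rewrite /weight etaE; field; rewrite !gt_eqF.
  have ug : 0 <= u%:R * short_step_gain mu2 eta by rewrite mulr_ge0 ?ler0n ?(ltW g0).
  have : 4 / lambda * (lambda / 2 * enorm (st.1.1 - xs) ^+ 2) <= 2^-1 * D ^+ 2.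
    apply: (@le_trans _ _ (potential eta f xs st)); last by lra.
    apply: le_trans pot; rewrite ler_wpM2r// mulr_ge0 ?sqr_ge0//.
    by rewrite divr_ge0 ?(ltW l0).
  have -> : 4 / lambda * (lambda / 2 * enorm (st.1.1 - xs) ^+ 2) =
    2 * enorm (st.1.1 - xs) ^+ 2 by field; rewrite gt_eqF.
  move=> h; rewrite -(@ler_pXn2r _ 2)// ?nnegrE ?enorm_ge0 ?divr_ge0 ?(ltW D0)//.
  by rewrite expr_div_n; lra.
have uN : (N < u)%N.
  rewrite -(ltn_add2l N) addnn -mul2n -[(2 * N)%N]add0n -ju.
  by rewrite ltn_add2r.
have pot0 : 0 <= potential eta f xs st.
  apply: le_trans pot; rewrite mulr_ge0 ?weight_ge0//.
  by rewrite mulr_ge0 ?sqr_ge0// divr_ge0 ?(ltW l0).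
have : N%:R * short_step_gain mu2 eta < u%:R * short_step_gain mu2 eta.
  by rewrite ltr_pM2r// ltr_nat.
suff : 2^-1 * D ^+ 2 <= N%:R * short_step_gain mu2 eta by lra.
have -> : N%:R * short_step_gain mu2 eta =
    N%:R ^+ 7 * lambda ^+ 2 / (2 * 12 ^+ 5 * mu2 ^+ 2).
  by rewrite /short_step_gain etaE; field; rewrite !gt_eqF.
rewrite ler_pdivlMr ?mulr_gt0 ?exprn_gt0//.
have -> : 2^-1 * D ^+ 2 * (2 * 12 ^+ 5 * mu2 ^+ 2) =
    (12 ^+ 5 * (mu2 * D / lambda) ^+ 2) * lambda ^+ 2.
  by field; rewrite gt_eqF.
by rewrite ler_wpM2r ?sqr_ge0.
Qed.

(** * Quadratic convergence of the Newton method *)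

Section Newton.
Variables (R : realType) (d : nat) (f : 'rV[R]_d -> R) (lambda mu2 : R).
Variable xs : 'rV[R]_d.
Hypotheses (mu2_gt0 : 0 < mu2) (lambda_gt0 : 0 < lambda).
Hypothesis f_diff : twice_differentiable f.
Hypothesis f_sc : strongly_convex lambda f.
Hypothesis f_hess : lipschitz_hessian mu2 f.
Hypothesis f_min : minimizer f xs.
Implicit Types x : 'rV[R]_d.

(** The gradient norm in the unit that makes a Newton step square it. *)
Definition residual x : R := mu2 * enorm (gradient f x) / lambda ^+ 2.

Lemma residual_ge0 x : 0 <= residual x.
Proof.
apply: divr_ge0 (sqr_ge0 _).
exact: mulr_ge0 (ltW mu2_gt0) (enorm_ge0 _).
Qed.

(** The step cancels the linearized gradient, so that the new gradient is the
    Taylor remainder. *)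
Lemma newton_residual x : exists s,
  s *m hessian f x = - gradient f x /\
  residual (newton f x) <= (mu2 * enorm s / lambda) ^+ 2.
Proof.
exists (- (gradient f x *m invmx (hessian f x))).
have HU : hessian f x \in unitmx.
  exact: coercive_unitmx lambda_gt0 (hessian_lower_bound f_sc x).
set s := - _; have hs : s *m hessian f x = - gradient f x.
  by rewrite mulNmx mulmxKV.
split=> //; have := gradient_taylor f_diff f_hess x s (ltW mu2_gt0).
rewrite hs opprK subrK -/(newton f x) => h.
rewrite /residual expr_div_n ler_pM2r ?invr_gt0 ?exprn_gt0//.
by rewrite exprMn [mu2 ^+ 2]expr2 -mulrA ler_pM2l.
Qed.

Lemma residual_newton x : residual (newton f x) <= residual x ^+ 2.
Proof.
have [s [hs /le_trans]] := newton_residual x; apply.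
have h := coercive_solution_bound (hessian_lower_bound f_sc x) hs.
rewrite ler_pXn2r ?nnegrE ?divr_ge0 ?mulr_ge0 ?enorm_ge0 ?sqr_ge0 ?(ltW mu2_gt0)
  ?(ltW lambda_gt0)//.
rewrite /residual ler_pdivrMr// expr2 invfM !mulrA divfK ?gt_eqF//.
by rewrite ler_pdivlMr// -mulrA ler_pM2l// mulrC.
Qed.

(** Since the gradient vanishes at xs, a Newton step s differs from xs - x by at
    most mu2 |x - xs|^2 / lambda; thus |s| is at most 5/4 of |x - xs|, and
    (5/16)^2 <= 1/2. *)
Lemma residual_first_newton x :
  mu2 * enorm (x - xs) / lambda <= 1 / 4 -> residual (newton f x) <= 1 / 2.
Proof.
move=> hx; have [s [hs /le_trans]] := newton_residual x; apply.
have := gradient_taylor f_diff f_hess x (xs - x) (ltW mu2_gt0).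
rewrite subrKC (gradient_minimizer f_diff f_min) sub0r -hs -mulmxBl (enormB xs) => h.
set e := (s - (xs - x)) *m hessian f x in h.
have {h} h : lambda * enorm (s - (xs - x)) <= mu2 * enorm (x - xs) ^+ 2.
  rewrite (le_trans _ h)// -(enormN e).
  by apply: coercive_solution_bound (hessian_lower_bound f_sc x) _; rewrite opprK.
have hs' : enorm s <= enorm (s - (xs - x)) + enorm (x - xs).
  by rewrite -{1}(subrK (xs - x) s) (le_trans (enormD _ _))// (enormB xs).
move: h hs' hx; have := enorm_ge0 s; have := enorm_ge0 (x - xs).
move: (enorm s) (enorm (x - xs)) (enorm (s - _)) => a b c b0 a0 h ha.
rewrite ler_pdivrMr// => hb.
have h' : mu2 * c <= 1 / 16 * lambda.
  rewrite -(ler_pM2l lambda_gt0); apply: (@le_trans _ _ ((mu2 * b) ^+ 2)).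
    by rewrite exprMn [mu2 ^+ 2]expr2 -mulrA mulrCA ler_pM2l.
  have -> : lambda * (1 / 16 * lambda) = (1 / 4 * lambda) ^+ 2 by field.
  by rewrite ler_pXn2r ?nnegrE ?mulr_ge0 ?(ltW mu2_gt0) ?(ltW lambda_gt0).
have h2 : mu2 * a <= mu2 * (c + b) by rewrite ler_pM2l.
have h3 : mu2 * a / lambda <= 5 / 16 by rewrite ler_pdivrMr//; lra.
apply: (@le_trans _ _ ((5 / 16) ^+ 2)); last by lra.
by rewrite ler_pXn2r ?nnegrE ?divr_ge0 ?mulr_ge0 ?(ltW mu2_gt0) ?(ltW lambda_gt0).
Qed.

Lemma residual_iter_newton n x :
  mu2 * enorm (x - xs) / lambda <= 1 / 4 ->
  residual (iter n.+1 (newton f) x) <= (1 / 2) ^+ (2 ^ n).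
Proof.
move=> hx; elim: n => [|n IH].
  by rewrite expn0 expr1; exact: residual_first_newton.
rewrite iterS (le_trans (residual_newton _))// expnS mulnC exprM.
by rewrite ler_pXn2r ?nnegrE ?residual_ge0 ?exprn_ge0 ?divr_ge0.
Qed.

Lemma gap_residual w : residual w <= 1 ->
  f w - f xs <= lambda ^+ 3 / mu2 ^+ 2 * residual w.
Proof.
move=> r1; have := gap_upper_bound f_diff f_sc xs w lambda_gt0.
move=> /le_trans; apply.
have r0 := residual_ge0 w.
have -> : enorm (gradient f w) ^+ 2 / (2 * lambda) =
    lambda ^+ 3 / mu2 ^+ 2 * (residual w ^+ 2 / 2).
  by rewrite /residual; field; rewrite !gt_eqF.
rewrite ler_wpM2l ?divr_ge0 ?exprn_ge0 ?(ltW mu2_gt0) ?(ltW lambda_gt0)//.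
nra.
Qed.

End Newton.

(** * Choice of the parameters *)

Section ParameterChoice.
Variable R : realType.
Implicit Types t x y : R.

Lemma ln2_ge_half : 1 / 2 <= ln (2 : R).
Proof.
rewrite -ler_expR lnK ?posrE//.
have := expR_ge1Dx (- (1 / 2) : R); rewrite expRN -[(expR _)^-1]div1r.
by rewrite ler_pdivlMr ?expR_gt0//; lra.
Qed.

Lemma ln2_gt0 : 0 < ln (2 : R).
Proof. by apply: lt_le_trans ln2_ge_half; lra. Qed.

Lemma le_pow2 y n : 0 < y -> log2 y <= n%:R -> y <= 2 ^+ n.
Proof.
rewrite /log2 => y0; rewrite ler_pdivrMr ?ln2_gt0// => h.
by rewrite -ler_ln ?posrE ?exprn_gt0// lnXn// -[_ *+ n]mulr_natl.
Qed.

Lemma max1_truncn x (M := Num.max 1 x) :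
  M <= (Num.truncn M).+1%:R <= 2 * M.
Proof.
have M1 : 1 <= M by rewrite le_max lexx.
have := @Num.Theory.truncn_itv _ M (le_trans ler01 M1).
by rewrite -natr1 => /andP[a b]; apply/andP; split; lra.
Qed.

(** N + 1 exceeds 6 max (1, t^(2/7)), and 12^5 <= 6^7. *)
Lemma exists_epoch_length t : 0 < t -> exists N : nat,
  12 ^+ 5 * t ^+ 2 <= N.+1%:R ^+ 7 /\
  N.+1%:R <= 7 * Num.max 1 (t `^ (2 / 7)).
Proof.
move=> t0; set K := t `^ (2 / 7); set M := Num.max 1 K.
have M1 : 1 <= M by rewrite le_max lexx.
have KM : K <= M by rewrite le_max lexx orbT.
have M60 : 0 <= 6 * M by lra.
have /andP[a b] := @Num.Theory.truncn_itv _ (6 * M) M60.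
exists (Num.truncn (6 * M)); split; last by rewrite -natr1; lra.
apply: (@le_trans _ _ ((6 * M) ^+ 7)).
  have -> : t ^+ 2 = K ^+ 7.
    rewrite -!powR_mulrn ?powR_ge0 ?(ltW t0)// -powRrM.
    by congr (_ `^ _); field.
  rewrite exprMn; apply: ler_pM; rewrite ?exprn_ge0 ?powR_ge0//.
    (* Numerals are unary: the powers are compared after cancelling 6^5. *)
    have -> : 12 = 6 * 2 :> R by ring.
    rewrite exprMn (exprD 6 5 2) ler_pM2l ?exprn_gt0//.
    by lra.
  by rewrite ler_pXn2r ?nnegrE ?powR_ge0// (le_trans ler01).
by rewrite ler_pXn2r ?nnegrE// ltW.
Qed.

Lemma exists_epoch_number t x : 0 < t -> t ^+ 2 <= x -> exists m : nat,
  4 * t <= 2 ^+ m.+1 /\ m.+1%:R <= 4 * Num.max 1 (log2 x).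
Proof.
move=> t0 tx; have /andP[a b] := max1_truncn (log2 x).
move: a b; set M := Num.max 1 _; move: (Num.truncn M) => q a b.
have M1 : 1 <= M by rewrite le_max lexx.
have LM : log2 x <= M by rewrite le_max lexx orbT.
exists q.+2; split; last by move: b; rewrite -!natr1; lra.
have -> : 2 ^+ q.+3 = 4 * 2 ^+ q.+1 :> R by rewrite 2!exprS mulrA -natrM.
rewrite ler_pM2l//; have [t1|t1] := leP t 1.
  by rewrite (le_trans t1)// exprn_ege1// ler1n.
apply: le_trans (le_pow2 _ (le_trans LM a)).
  by rewrite (le_trans _ tx)// expr2 ler_peMl ?ltW.
by rewrite (lt_le_trans _ tx)// exprn_gt0.
Qed.

Lemma exists_newton_number y : 0 < y -> exists n : nat,
  y <= 2 ^+ (2 ^ n) /\ n%:R + 2 <= 5 * Num.max 1 (ln (log2 y)).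
Proof.
move=> y0; set M := Num.max 1 _.
have M1 : 1 <= M by rewrite le_max lexx.
have LM : ln (log2 y) <= M by rewrite le_max lexx orbT.
have M20 : 0 <= 2 * M by lra.
have /andP[a b] := @Num.Theory.truncn_itv _ (2 * M) M20.
move: (Num.truncn (2 * M)) a b => q a b.
exists q.+1; split; last by rewrite -natr1; lra.
apply: le_pow2 => //; rewrite natrX.
have [l1|l1] := leP (log2 y) 1; first by rewrite (le_trans l1)// exprn_ege1// ler1n.
have l0 : 0 < log2 y by apply: lt_trans l1.
apply: le_pow2 => //; rewrite [log2 (log2 y)]/(ln (log2 y) / ln 2).
rewrite ler_pdivrMr ?ln2_gt0//.
have h : q.+1%:R * (1 / 2) <= q.+1%:R * ln (2 : R) by rewrite ler_wpM2l ?ln2_ge_half.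
by apply: le_trans h; lra.
Qed.

End ParameterChoice.

(** * The number of oracle calls *)

Lemma epochs_distance (R : realType) d (f : 'rV[R]_d -> R) (lambda mu2 D : R)
    (xs x : 'rV[R]_d) (N m : nat) :
  0 < mu2 -> 0 < lambda -> 0 < D ->
  twice_differentiable f -> strongly_convex lambda f ->
  lipschitz_hessian mu2 f -> minimizer f xs ->
  12 ^+ 5 * (mu2 * D / lambda) ^+ 2 <= N.+1%:R ^+ 7 ->
  enorm (x - xs) <= D ->
  enorm (iter m (epoch mu2 (4 / (lambda * N.+1%:R ^+ 3)) f (2 * N.+1)) x - xs)
    <= D / 2 ^+ m.
Proof.
move=> mu20 l0 D0 f_diff f_sc f_hess f_min hN hx.
elim: m => [|m IH]; first by rewrite expr0 divr1.
have Dm : 0 < D / 2 ^+ m by rewrite divr_gt0 ?exprn_gt0.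
have -> : D / 2 ^+ m.+1 = D / 2 ^+ m / 2 by rewrite exprSr invfM mulrA.
rewrite iterS.
refine (epoch_halves mu20 l0 Dm (ltn0Sn N) f_diff f_sc f_hess f_min _ IH).
apply: le_trans hN.
rewrite ler_wpM2l ?exprn_ge0//.
have u0 E : 0 < E -> mu2 * E / lambda \is Num.nneg.
  by move=> E0; rewrite nnegrE ltW// divr_gt0// mulr_gt0.
rewrite ler_pXn2r ?u0// ler_pM2r ?invr_gt0// ler_pM2l//.
by rewrite ler_pdivrMr ?exprn_gt0// ler_peMr ?(ltW D0)// exprn_ege1// ler1n.
Qed.

Theorem mainTheorem4 (R : realType) :
  exists C : R, 0 < C /\
  forall mu1 mu2 lambda D eps : R,
    0 < mu1 -> 0 < mu2 -> 0 < lambda -> 0 < D -> 0 < eps ->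
  exists A : forall d : nat, 'rV[R]_d -> algorithm R d,
    (forall (d : nat) (w1 : 'rV[R]_d), A d w1 [::] = w1) /\
    forall (d : nat) (w1 : 'rV[R]_d) (f : 'rV[R]_d -> R) (wstar : 'rV[R]_d),
      twice_differentiable f ->
      strongly_convex lambda f ->
      lipschitz_gradient mu1 f ->
      lipschitz_hessian mu2 f ->
      minimizer f wstar ->
      enorm (w1 - wstar) <= D ->
      exists T : nat,
        (0 < T)%N /\
        T%:R <= C * complexity mu1 mu2 lambda D eps /\
        f (query (A d w1) f T) - f wstar <= eps.
Proof.
(* Each epoch makes 2 N steps of 3 calls, with N <= 7 K and at most 4 L epochs:
   this gives 6 * 7 * 4 calls. *)
exists 168; split=> // mu1 mu2 lambda D eps mu10 mu20 l0 D0 e0.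
pose t := mu2 * D / lambda.
have t0 : 0 < t by rewrite divr_gt0 ?mulr_gt0.
pose X := mu1 * mu2 ^+ 2 * D ^+ 2 / lambda ^+ 3.
pose Y := lambda ^+ 3 / (mu2 ^+ 2 * eps).
have Y0 : 0 < Y by rewrite divr_gt0 ?mulr_gt0 ?exprn_gt0.
have [N [hN NK]] := exists_epoch_length t0.
(* For mu1 < lambda only d = 0 is possible, and any number of epochs will do. *)
have [m [hm mL]] : exists m : nat,
    (lambda <= mu1 -> 4 * t <= 2 ^+ m.+1) /\
    m.+1%:R <= 4 * Num.max 1 (log2 X).
  have [lm|lm] := leP lambda mu1; last first.
    exists 0%N; split=> //.
    have : 1 <= Num.max 1 (log2 X) by rewrite le_max lexx.
    lra.
  have tX : t ^+ 2 <= X.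
    have -> : X = mu1 / lambda * t ^+ 2 by rewrite /X /t; field; rewrite gt_eqF.
    by rewrite ler_peMl ?sqr_ge0// ler_pdivlMr// mul1r.
  by have [m [hm mL]] := exists_epoch_number t0 tX; exists m.
have [n [hn nM]] := exists_newton_number Y0.
pose eta := 4 / (lambda * N.+1%:R ^+ 3).
pose p d w1 : prog R d := epochs_prog mu2 eta (2 * N.+1) m.+1 w1
  (newton_prog (d := d) n.+1).
exists (fun d w1 => algorithm_of (p d w1)); split=> [d w1|]; first by [].
move=> d w1 f ws f_diff f_sc f_lip f_hess f_min hD.
have K1 : 1 <= Num.max 1 (t `^ (2 / 7)) by rewrite le_max lexx.
have L1 : 1 <= Num.max 1 (log2 X) by rewrite le_max lexx.
have M1 : 1 <= Num.max 1 (ln (log2 Y)) by rewrite le_max lexx.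
have KL1 : 1 <= Num.max 1 (t `^ (2 / 7)) * Num.max 1 (log2 X).
  by rewrite (le_trans K1)// ler_peMr// (le_trans ler01).
rewrite /complexity -/t -/X -/Y.
case: d w1 f ws f_diff f_sc f_lip f_hess f_min hD => [|d] w1 f ws f_diff f_sc
  f_lip f_hess f_min hD.
  exists 1%N; split=> //; split; first by lra.
  have -> : query (algorithm_of (p 0%N w1)) f 1 = ws.
    by apply/matrixP => i [].
  by rewrite subrr ltW.
have lm := strong_convexity_le_lipschitz f_diff f_sc f_lip.
exists (3 * (2 * N.+1) * m.+1 + n.+1).+1; split=> //; split.
  have h : N.+1%:R * m.+1%:R <=
      7 * Num.max 1 (t `^ (2 / 7)) * (4 * Num.max 1 (log2 X)).
    by rewrite ler_pM.
  have -> : (3 * (2 * N.+1) * m.+1 + n.+1).+1%:R =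
      6 * (N.+1%:R * m.+1%:R) + (n%:R + 2) :> R.
    by rewrite -natr1 natrD !natrM -(natr1 n); ring.
  lra.
rewrite query_advance advanceD advance_epochs advance_newton.
set w := iter m.+1 _ _.
have hw : mu2 * enorm (w - ws) / lambda <= 1 / 4.
  have hd := epochs_distance m.+1 mu20 l0 D0 f_diff f_sc f_hess f_min hN hD.
  apply: (@le_trans _ _ (mu2 * (D / 2 ^+ m.+1) / lambda)).
    by rewrite ler_pM2r ?invr_gt0// ler_pM2l.
  have -> : mu2 * (D / 2 ^+ m.+1) / lambda = t / 2 ^+ m.+1.
    by rewrite /t mulrA mulrAC.
  rewrite ler_pdivrMr ?exprn_gt0//; have := hm lm; lra.
have hr := residual_iter_newton mu20 l0 f_diff f_sc f_hess f_min n hw.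
have p2 : (1 / 2) ^+ (2 ^ n) <= 1 :> R by rewrite exprn_ile1// ?divr_ge0//; lra.
have := gap_residual ws mu20 l0 f_diff f_sc (le_trans hr p2).
move=> /le_trans; apply.
have -> : lambda ^+ 3 / mu2 ^+ 2 = Y * eps by rewrite /Y; field; rewrite !gt_eqF.
have Ye0 : 0 < Y * eps by rewrite mulr_gt0.
apply: (@le_trans _ _ (Y * eps * (1 / 2) ^+ (2 ^ n))); first by rewrite ler_pM2l.
by rewrite expr_div_n expr1n mul1r ler_pdivrMr ?exprn_gt0// mulrC ler_pM2l.
Qed.
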